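(* Let $G$ be a graph. The following conditions are equivalent. (1) Every vertex of $G$ is a shedding vertex. (2) $\mathcal{A}_G=\mathcal{F}_G$.
   Context: Graphs are finite and simple. A set $A\subset V(G)$ is stable if no two of its vertices are joined by an edge (the empty set is stable); maximal means maximal with respect to inclusion. A set $C\subset V(G)$ is a vertex cover if every edge of $G$ is incident with a vertex of $C$; it is minimal if no proper subset is a vertex cover. $N_G(v)$ is the set of vertices adjacent to $v$, $N_G[v]=N_G(v)\cup\{v\}$, and $N_G(A)=\bigcup_{a\in A}N_G(a)$. For $A\subset V(G)$, $G\setminus A$ is the induced subgraph of $G$ on $V(G)\setminus A$, and $G\setminus v=G\setminus\{v\}$. $\mathcal{F}_G$ is the family of all maximal stable sets of $G$. $\mathcal{A}_G$ is the family of all stable sets $A$ of $G$ such that $N_G(A)$ is a minimal vertex cover of $G$. A vertex $v$ of $G$ is a shedding vertex if each stable set of $G\setminus N_G[v]$ is not a maximal stable set of $G\setminus v$. *)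

(* Defs.v *)
From mathcomp Require Import all_boot.

Set Implicit Arguments.
Unset Strict Implicit.
Unset Printing Implicit Defensive.

(* A finite simple graph whose vertex set is a subset of an ambient finite
   type, so that a graph and its induced subgraphs live in the same type. *)
Record graph (T : finType) := Graph {
  vertices : {set T};
  adj : rel T;
  adj_sym : symmetric adj;
  adj_irr : irreflexive adj;
  adj_vertices : forall x y, adj x y -> x \in vertices
}.

Section GraphDefs.
Variable T : finType.
Implicit Types (G : graph T) (A C : {set T}) (v : T).

Definition del_adj G A : rel T :=
  [rel x y | [&& x \notin A, y \notin A & adj G x y]].

Lemma del_adj_sym G A : symmetric (del_adj G A).
Proof. by move=> x y; rewrite /del_adj /= adj_sym andbCA. Qed.

Lemma del_adj_irr G A : irreflexive (del_adj G A).
Proof. by move=> x; rewrite /del_adj /= adj_irr !andbF. Qed.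

Lemma del_adj_vertices G A x y :
  del_adj G A x y -> x \in vertices G :\: A.
Proof. by case/and3P=> xA _ /adj_vertices xG; rewrite inE xA. Qed.

Definition del G A : graph T :=
  Graph (@del_adj_sym G A) (@del_adj_irr G A) (@del_adj_vertices G A).

Definition nbhd G v : {set T} := [set w | adj G v w].
Definition cnbhd G v : {set T} := v |: nbhd G v.
Definition nbhds G A : {set T} := \bigcup_(a in A) nbhd G a.

Definition stable G A : bool :=
  (A \subset vertices G) && [forall x in A, forall y in A, ~~ adj G x y].

Definition maximal_stable G A : bool := maxset (stable G) A.

Definition vertex_cover G C : bool :=
  (C \subset vertices G) &&
  [forall x, forall y, adj G x y ==> (x \in C) || (y \in C)].

Definition minimal_vertex_cover G C : bool := minset (vertex_cover G) C.

Definition max_stable_sets G : {set {set T}} := [set A | maximal_stable G A].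

Definition stable_sets_covering_nbhd G : {set {set T}} :=
  [set A | stable G A && minimal_vertex_cover G (nbhds G A)].

Definition shedding G v : Prop :=
  forall A, stable (del G (cnbhd G v)) A ->
    ~~ maximal_stable (del G [set v]) A.

End GraphDefs.

(* Main.v *)
Require Import Defs.
From mathcomp Require Import all_boot.

(** Everything is read off the order-reversing operator [free G], which sends a
    set [A] to the vertices having no neighbour in [A]. A set is stable when
    [A \subset free G A], and maximal stable when [A = free G A]. The members of
    [stable_sets_covering_nbhd G] are the sets [A] with [A \subset free G A] and
    [free G A] stable: the complement of a vertex cover is stable, and the cover
    [nbhds G A] is automatically minimal because each of its vertices has a
    neighbour in [A], outside the cover. Hence maximal stable sets always
    belong to [stable_sets_covering_nbhd G], and the two families differ exactly
    when the latter contains some [A] strictly smaller than [free G A].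

    Likewise a set [A] shows that a vertex [v] is not shedding exactly when
    [free G A] is [A] with one extra element, [v]
    ([not_shedding_witnessE]). Such an [A] lies in [stable_sets_covering_nbhd G]
    and is not maximal. Conversely, if [A] is in that family and [v] is in
    [free G A] but not in [A], then removing [v] from the stable set
    [B := free G A] gives [A \subset B :\ v \subset B], so
    [free G (B :\ v)] is squeezed between [B \subset free G B] and
    [free G A = B]; thus [B :\ v] shows that [v] is not shedding. *)

Section FreeVertices.
#[local] Set Implicit Arguments.
#[local] Unset Strict Implicit.
Variables (T : finType) (G : graph T).
Implicit Types (A B C : {set T}) (x v : T).

Definition free A : {set T} := vertices G :\: nbhds G A.

Lemma nbhdsP A x : reflect (exists2 a, a \in A & adj G a x) (x \in nbhds G A).
Proof.
by apply: (iffP bigcupP) => -[a aA ax]; exists a => //; move: ax; rewrite inE.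
Qed.

Lemma nbhds_sub A : nbhds G A \subset vertices G.
Proof.
apply/subsetP => x /nbhdsP[a _]; rewrite adj_sym; exact: adj_vertices.
Qed.

Lemma freeP A x :
  reflect (x \in vertices G /\ {in A, forall a, ~~ adj G a x}) (x \in free A).
Proof.
rewrite inE andbC; apply: (iffP andP) => -[xG xA]; split=> //.
  by move=> a aA; apply: contra xA => ax; apply/nbhdsP; exists a.
by apply/nbhdsP => -[a /xA /negP].
Qed.

Lemma freeS A B : A \subset B -> free B \subset free A.
Proof.
move=> /subsetP AB; apply/subsetP => x /freeP[xG xB].
by apply/freeP; split=> // a /AB /xB.
Qed.

Lemma stableE A : stable G A = (A \subset free A).
Proof.
apply/andP/subsetP => [[/subsetP AG /forall_inP st] x xA | st].
  by apply/freeP; split=> [|a /st /forall_inP]; [exact: AG | exact].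
split; first by apply/subsetP => x /st /freeP[].
by apply/forall_inP => x xA; apply/forall_inP => y /st /freeP[_]; apply.
Qed.

Lemma stable_setU1 A x : A \subset free A -> x \in free A -> stable G (x |: A).
Proof.
move=> /subsetP st /freeP[xG xA]; rewrite stableE; apply/subsetP => y.
case/setU1P=> [-> | yA]; apply/freeP; split=> //.
- by move=> a /setU1P[-> | /xA //]; rewrite adj_irr.
- by case/freeP: (st y yA).
- move=> a /setU1P[-> | aA]; first by rewrite adj_sym xA.
  by case/freeP: (st y yA) => _; apply.
Qed.

(** A stable [A] can be enlarged by any element of [free A]; conversely a
    stable [B] containing [A] satisfies [B \subset free B \subset free A]. *)
Lemma maximal_stableE A : maximal_stable G A = (A == free A).
Proof.
apply/maxsetP/eqP => [[] | eqA].
  rewrite stableE => st maxA; apply/eqP; rewrite eqEsubset st.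
  apply/subsetP => x xA.
  by rewrite -(maxA _ (stable_setU1 st xA) (subsetUr _ _)) setU11.
split=> [|B]; rewrite stableE -?eqA // => stB AB.
apply/eqP; rewrite eqEsubset AB andbT.
by apply: subset_trans stB _; rewrite eqA freeS.
Qed.

Lemma vertex_coverE C :
  vertex_cover G C = (C \subset vertices G) && stable G (vertices G :\: C).
Proof.
rewrite /vertex_cover /stable subsetDl; congr (_ && _).
apply/forallP/forall_inP => [cov x /setDP[_ xC] | st x].
  apply/forall_inP => y /setDP[_ yC]; move/forallP: (cov x) => /(_ y).
  by rewrite (negPf xC) (negPf yC) implybF.
apply/forallP => y; apply/implyP => xy; apply: contraLR xy; rewrite negb_or.
case/andP=> xC yC; apply/negP => xy.
have xG := adj_vertices xy.
have yG : y \in vertices G by apply: (@adj_vertices _ G y x); rewrite adj_sym.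
have xD : x \in vertices G :\: C by rewrite inE xC.
have yD : y \in vertices G :\: C by rewrite inE yC.
by have /forall_inP/(_ y yD)/negP := st x xD; apply.
Qed.

(** Minimality of the cover comes for free: if [C \subset nbhds G A] is a
    cover, the stable set [vertices G :\: C] contains [A], hence is contained
    in [free A]. *)
Lemma stable_sets_covering_nbhdE A :
  (A \in stable_sets_covering_nbhd G) = (A \subset free A) && stable G (free A).
Proof.
rewrite inE stableE; case: (boolP (A \subset free A)) => //= stA.
apply/minsetP/idP => [[] | stF]; first by rewrite vertex_coverE => /andP[].
split=> [|C]; first by rewrite vertex_coverE nbhds_sub.
rewrite vertex_coverE stableE => /andP[CG stC] CN.
apply/eqP; rewrite eqEsubset CN; apply/subsetP => x xN.
have AC : A \subset vertices G :\: C.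
  by apply: subset_trans stA _; apply: setDS.
apply: contraLR (xN) => xC.
have xD : x \in vertices G :\: C by rewrite inE xC (subsetP (nbhds_sub A)).
by have /(subsetP (freeS AC)) := subsetP stC x xD; case/setDP.
Qed.

Lemma max_stable_setsE A : (A \in max_stable_sets G) = (A == free A).
Proof. by rewrite inE maximal_stableE. Qed.

Lemma max_stable_sets_sub : max_stable_sets G \subset stable_sets_covering_nbhd G.
Proof.
apply/subsetP => A; rewrite max_stable_setsE stable_sets_covering_nbhdE stableE.
by move=> /eqP eqA; rewrite -!eqA subxx.
Qed.

End FreeVertices.

Section Deletion.
#[local] Set Implicit Arguments.
#[local] Unset Strict Implicit.
Variables (T : finType) (G : graph T).
Implicit Types (A D : {set T}) (v : T).

Lemma free_del A D :
  [disjoint A & D] -> free (del G D) A = free G A :\: D.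
Proof.
move=> dAD; apply/setP => x; rewrite [RHS]inE.
apply/freeP/andP => [[/setDP[xG xD] xA] | [xD /freeP[xG xA]]].
  split=> //; apply/freeP; split=> // a aA; apply: contra (xA a aA) => ax.
  by apply/and3P; rewrite (disjointFr dAD aA) xD.
split=> [|a aA]; first by rewrite inE xD.
by apply: contra (xA a aA) => /and3P[].
Qed.

(** Maximality in [G] without [v] gives [A = free G A :\ v], and avoiding the
    closed neighbourhood of [v] gives [v \in free G A]. *)
Lemma not_shedding_witnessE v A :
  v \in vertices G ->
  stable (del G (cnbhd G v)) A && maximal_stable (del G [set v]) A =
  (v \notin A) && (v |: A == free G A).
Proof.
move=> vG; apply/andP/andP => [[/andP[/subsetP AD _]] | [vA /eqP eqA]].
  have vA : v \notin A by apply/negP => /AD; rewrite !inE eqxx.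
  have dA : [disjoint A & [set v]] by rewrite disjoint_sym disjoints1.
  rewrite maximal_stableE (free_del dA) => /eqP eqA; split=> //.
  rewrite {1}eqA setD1K //; apply/freeP; split=> // a /AD.
  by rewrite adj_sym !inE negb_or => /andP[/andP[]].
have dA : [disjoint A & [set v]] by rewrite disjoint_sym disjoints1.
have vF : v \in free G A by rewrite -eqA setU11.
have dAN : [disjoint A & cnbhd G v].
  apply/pred0P => x /=; apply/negP => /andP[xA /setU1P[xv | ]].
    by rewrite -xv xA in vA.
  by rewrite inE adj_sym; case/freeP: vF => _ /(_ x xA) /negPf ->.
rewrite stableE maximal_stableE !free_del // -eqA setU1K //; split=> //.
by rewrite subsetD dAN subsetUr.
Qed.

End Deletion.

Theorem proposition4p11 (T : finType) (G : graph T) :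
  (forall v : T, v \in vertices G -> shedding G v) <->
  stable_sets_covering_nbhd G = max_stable_sets G.
Proof.
split=> [shed | eqAF v vG A stA].
  apply/eqP; rewrite eqEsubset max_stable_sets_sub andbT.
  apply/subsetP => A; rewrite stable_sets_covering_nbhdE max_stable_setsE.
  rewrite stableE eqEsubset => /andP[AF stF]; rewrite AF.
  apply/subsetP => v vF; apply/negPn/negP => vA.
  have vG : v \in vertices G by case/freeP: vF.
  suff /andP[stW] : stable (del G (cnbhd G v)) (free G A :\ v)
      && maximal_stable (del G [set v]) (free G A :\ v).
    by apply/negP; apply: shed.
  rewrite not_shedding_witnessE // setD11 setD1K // eqEsubset /=.
  apply/andP; split; last by apply: freeS; rewrite subsetD1 AF.
  by apply: subset_trans stF _; apply: freeS; apply: subsetDl.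
apply/negP => maxA.
have: stable (del G (cnbhd G v)) A && maximal_stable (del G [set v]) A.
  by rewrite stA.
rewrite not_shedding_witnessE // => /andP[vA /eqP eqA].
have AF : A \subset free G A by rewrite -eqA subsetUr.
have vF : v \in free G A by rewrite -eqA setU11.
have: A \in stable_sets_covering_nbhd G.
  by rewrite stable_sets_covering_nbhdE AF -eqA stable_setU1.
by rewrite eqAF max_stable_setsE => /eqP eqF; rewrite eqF vF in vA.
Qed.
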